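(* Let $E\in\{\mathscr D_a,\mathscr D,\mathscr S\}$ (with $a>0$). Let $\gamma_1\in C(0)$ be such that $\sup_{|t|\le 1}|\gamma_1(t)|=1$ and $|\gamma_1(\alpha)|\le|\gamma_1(\beta)|$ whenever $|\alpha|\le|\beta|\le 1$. Then for every $U\in\mathcal N(E)$, every $f\in E^{[\gamma_1,U]}$ and every $\varepsilon>0$ there is a $V\in\mathcal N(E)$ such that $\gamma_1\circ\gamma_1\in C(0)$ and $$h\circ f\in E^{(\gamma_1\circ\gamma_1,V)}\quad\text{for all } h\in\mathscr L_{\gamma_1,\varepsilon}(\mathbb C,\mathbb C),$$ $$h\circ f\in E^{[\gamma_1\circ\gamma_1,V]}\quad\text{for all } h\in\mathscr K_{\gamma_1,\varepsilon}(\mathbb C,\mathbb C).$$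
   Context: Test function spaces on $\mathbb R^n$ ($n\ge1$), all over $\mathbb C$: for $a>0$, $\mathscr D_a$ is the Fréchet space of infinitely differentiable $\xi:\mathbb R^n\to\mathbb C$ with $\xi(x)=0$ for $|x|>a$ (Euclidean norm), with norms $\|\xi\|_p=\sup_{|x|\le a}\max_{|q|\le p}|D^q\xi(x)|$, $p=0,1,2,\dots$; $\mathscr D=\bigcup_{m\ge1}\mathscr D_m$ is the strict inductive limit of the $\mathscr D_m$; $\mathscr S$ is the Fréchet space of infinitely differentiable rapidly decreasing functions with norms $\|\xi\|_p=\sup_{|k|,|q|\le p,\,x\in\mathbb R^n}|x^kD^q\xi(x)|$ ($k,q$ multi-indices). $\mathcal N(X)$ is the family of neighborhoods of $0$ in a topological vector space $X$. $C(0)$ is the set of functions $\gamma:\mathbb C\to\mathbb C$ with $\lim_{t\to0}\gamma(t)=\gamma(0)=0$ and $|\gamma(t)|\ge|t|$ for $|t|\le1$. For topological vector spaces $X,Y$ over $\mathbb C$, $\gamma\in C(0)$ and $U\in\mathcal N(X)$: $\mathscr L_{\gamma,U}(X,Y)$ is the set of $f:X\to Y$ with $f(0)=0$ such that for all $x\in X$, $u\in U$ and scalars $|t|\le1$ there are scalars $r,s$ with $|r-1|\le|\gamma(t)|$, $|s|\le|\gamma(t)|$ and $f(x+tu)=rf(x)+sf(u)$. $\mathscr K_{\gamma,U}(X,Y)$ is the set of $f\in\mathscr L_{\gamma,U}(X,Y)$ such that for all $x\in X$, $u\in U$, $|t|\le1$ one has $f(x+tu)=f(x)+sf(u)$ for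 some scalar $s$ with $|s|\le|\gamma(t)|$. For $\varepsilon>0$, $\mathscr L_{\gamma,\varepsilon}(\mathbb C,\mathbb C)$ and $\mathscr K_{\gamma,\varepsilon}(\mathbb C,\mathbb C)$ denote $\mathscr L_{\gamma,U}(\mathbb C,\mathbb C)$ and $\mathscr K_{\gamma,U}(\mathbb C,\mathbb C)$ with $U=\{z\in\mathbb C:|z|<\varepsilon\}$. $E^{(\gamma,U)}$ is the set of continuous $f\in\mathscr L_{\gamma,U}(E,\mathbb C)$ (demi-distributions), and $E^{[\gamma,U]}$ the set of continuous $f\in\mathscr K_{\gamma,U}(E,\mathbb C)$. *)

(* Defs.v *)
From HB Require Import structures.
From mathcomp Require Import all_boot all_order all_algebra complex.
From mathcomp Require Import all_classical all_reals all_analysis.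

Set Implicit Arguments.
Unset Strict Implicit.
Unset Printing Implicit Defensive.

Import Order.TTheory GRing.Theory Num.Theory.
Import numFieldNormedType.Exports.
Import ComplexField.Normc.

Local Open Scope classical_set_scope.
Local Open Scope ring_scope.
Local Open Scope complex_scope.

Section AbsConvex.
Context {K : numFieldType} {E : lmodType K}.

Definition absconvex (W : set E) : Prop :=
  forall (a b : K) (x y : E), `|a| + `|b| <= 1 -> W x -> W y ->
    W (a *: x + b *: y).

Definition absorbing (W : set E) : Prop :=
  forall x : E, exists2 r : K, 0 < r & forall c : K, `|c| <= r -> W (c *: x).

(* Filter base at 0 of a locally convex vector topology *)
Record is_local_base (B : set (set E)) : Prop := {
  local_base_neq0 : B !=set0;
  local_baseI : forall U V, B U -> B V -> exists2 W, B W & W `<=` U `&` V;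
  local_baseZ : forall U (c : K), B U ->
    exists2 V, B V & forall x, V x -> U (c *: x);
  local_base_absconvex : forall U, B U -> absconvex U;
  local_base_absorbing : forall U, B U -> absorbing U }.

End AbsConvex.

(* [PreTopologicalLmod_isTvs] alone only produces the uniform structure, so the
   continuity of the operations and local convexity are declared after it. *)
HB.factory Record hasLocalBase (K : numFieldType) (E : Type)
    & GRing.Lmodule K E := {
  local_base : set (set E);
  local_baseP : is_local_base local_base
}.

HB.builders Context K E & hasLocalBase K E.

Let B := local_base.
Let HB := local_baseP.

Definition nbhs_of_base (x : E) : set_system E :=
  [set A | exists2 U, B U & forall u, U u -> A (x + u)].

HB.instance Definition _ := hasNbhs.Build E nbhs_of_base.

Let B0 U : B U -> U 0.
Proof.
move=> /(local_base_absorbing HB)/(_ 0)[r r0 /(_ 0)].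
by rewrite normr0 scaler0 => /(_ (ltW r0)).
Qed.

Let Bhalf U : B U -> exists2 V, B V & forall x y, V x -> V y -> U (x + y).
Proof.
move=> BU; have [V BV VU] := local_baseZ HB 2 BU.
exists V => // x y /VU Ux /VU Uy.
have := local_base_absconvex HB BU (a := 2^-1) (b := 2^-1) _ Ux Uy.
rewrite !scalerA mulVf ?pnatr_eq0// !scale1r; apply.
by rewrite ger0_norm ?invr_ge0 ?ler0n// [leRHS](splitr 1) mul1r.
Qed.

Let nbhs_pfilter (p : E) : ProperFilter (nbhs p).
Proof.
apply: Build_ProperFilter_ex.
  by move=> A [U BU UA]; exists p; rewrite -[p]addr0; apply: UA; exact: B0.
split.
- by have [U BU] := local_base_neq0 HB; exists U.
- move=> A1 A2 [U BU UA] [V BV VA]; have [W BW WUV] := local_baseI HB BU BV.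
  by exists W => // u /WUV[Uu Vu]; split; [exact: UA|exact: VA].
- by move=> A1 A2 A12 [U BU UA]; exists U => // u /UA /A12.
Qed.

Let nbhs_single (p : E) (A : set E) : nbhs p A -> A p.
Proof. by move=> [U BU UA]; rewrite -[p]addr0; apply: UA; exact: B0. Qed.

Let nbhs_nbhs_ (p : E) (A : set E) : nbhs p A -> nbhs p (nbhs^~ A).
Proof.
move=> [U BU UA]; have [V BV VU] := Bhalf BU.
exists V => // u Vu; exists V => // v Vv.
by rewrite -addrA; apply: UA; exact: VU.
Qed.

HB.instance Definition _ := Nbhs_isNbhsTopological.Build E
  nbhs_pfilter nbhs_single nbhs_nbhs_.

Let add_cont : continuous (fun x : E * E => x.1 + x.2).
Proof.
move=> [x y] A [U BU UA]; have [V BV VU] := Bhalf BU.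
exists ([set x + v | v in V], [set y + v | v in V]) => /=.
  by split; exists V => // u Vu; exists u.
move=> [_ _] [/= [u Vu <-] [v Vv <-]] /=.
by rewrite addrACA; apply: UA; exact: VU.
Qed.

Let scale_cont : continuous (fun z : K^o * E => z.1 *: z.2).
Proof.
move=> [c x] A [U BU UA]; have [V BV VU] := Bhalf BU.
have [r r0 Vr] := local_base_absorbing HB BV x.
have [W BW WV] := local_baseZ HB (`|c| + r) BV.
exists (ball (c : K^o) r, [set x + w | w in W]) => /=.
  by split; [exact: nbhsx_ballx|exists W => // w Ww; exists w].
move=> [c' _] [/= cc' [w Ww <-]] /=.
have {}cc' : `|c' - c| < r by rewrite distrC.
rewrite -[c' *: (x + w)](addrNK (c *: x)) addrC; apply: UA.
rewrite scalerDr addrAC -scalerBl; apply: VU; first by apply/Vr/ltW.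
have cr0 : 0 < `|c| + r by rewrite ltr_wpDl.
have := local_base_absconvex HB BV (a := c' / (`|c| + r)) (b := 0) _
  (WV _ Ww) (B0 BV).
rewrite scaler0 addr0 scalerA divfK ?gt_eqF//; apply.
rewrite normr0 addr0 normrM normfV (gtr0_norm cr0) ler_pdivrMr// mul1r.
by rewrite -[c'](subrK c) (le_trans (ler_normD _ _))// addrC lerD2l ltW.
Qed.

Let loc_convex : exists2 BB : set_system E,
  (forall b, b \in BB -> convex_set b) & basis BB.
Proof.
exists [set O | open O /\ convex_set O].
  by move=> b; rewrite inE => -[].
split; first by move=> O [].
move=> x A [U BU UA].
exists [set y | nbhs y [set x + u | u in U]]; last first.
  move=> y /= /nbhs_single[u Uu <-]; exact: UA.
split; last by exists U => // u Uu; exists u.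
split; first by move=> y /= /nbhs_nbhs_.
apply/convex_setW => y z; rewrite !inE /= => -[V BV VU] [W BW WU] l l0 l1.
rewrite inE /=; have [T BT TVW] := local_baseI HB BV BW.
exists T => // t /TVW[/VU[u Uu xuE] /WU[u' Uu' xuE']].
exists (l%:num *: u + (1 - l%:num) *: u').
  have H : `|l%:num| + `|1 - l%:num| <= 1 :> K.
    have l0' := ltW l0; have l1' : 0 <= 1 - l%:num by rewrite subr_ge0; exact: ltW.
    rewrite (ger0_norm l0') (ger0_norm l1') addrC. rewrite subrK. exact: lexx.
  exact: (local_base_absconvex HB BU H Uu Uu').
have -> : conv l y z + t = l%:num *: (y + t) + (1 - l%:num) *: (z + t).
  rewrite !scalerDr addrACA -[X in _ = _ + X]scalerDl.
  by rewrite (addrC l%:num) subrK scale1r.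
rewrite -xuE -xuE' !scalerDr addrACA -[X in _ = X + _]scalerDl.
by rewrite (addrC l%:num) subrK scale1r.
Qed.

HB.instance Definition _ := PreTopologicalLmod_isTvs.Build K E
  add_cont scale_cont loc_convex.
HB.instance Definition _ :=
  PreTopologicalNmodule_isTopologicalNmodule.Build E add_cont.
HB.instance Definition _ :=
  TopologicalNmodule_isTopologicalLmodule.Build K E scale_cont.
HB.instance Definition _ := Uniform_isTvs.Build K E loc_convex.

HB.end.

Section SeminormTopology.
Context {R : realType} {E : lmodType R[i]}.

Record is_seminorm (p : E -> R) : Prop := {
  seminorm_ge0 : forall x, 0 <= p x;
  seminormD : forall x y, p (x + y) <= p x + p y;
  seminormZ : forall c x, p (c *: x) = normc c * p x }.

(* The topology defined by the sequence of seminorms [p] *)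
Definition seminorm_base (p : nat -> E -> R) : set (set E) :=
  [set U | exists k (e : R), 0 < e /\
    U = [set x | forall j, (j <= k)%N -> p j x < e]].

Lemma seminorm_baseP (p : nat -> E -> R) :
  (forall j, is_seminorm (p j)) -> is_local_base (seminorm_base p).
Proof.
move=> pP; have normcge0 (c : R[i]) : 0 <= normc c.
  by case: c => a b; exact: sqrtr_ge0.
split.
- by exists [set x | forall j, (j <= 0)%N -> p j x < 1]; exists 0%N, 1.
- move=> _ _ [k [e [e0 ->]]] [l [d [d0 ->]]].
  exists [set x | forall j, (j <= maxn k l)%N -> p j x < Num.min e d].
    by exists (maxn k l), (Num.min e d); rewrite lt_min e0 d0.
  move=> x /= xP; split=> j jk.
    by have := xP j; rewrite leq_max jk => /(_ isT); rewrite lt_min => /andP[].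
  have := xP j; rewrite leq_max jk orbT => /(_ isT).
  by rewrite lt_min => /andP[].
- move=> _ c [k [e [e0 ->]]].
  have c1 : 0 < normc c + 1 by rewrite ltr_wpDl.
  exists [set x | forall j, (j <= k)%N -> p j x < e / (normc c + 1)].
    by exists k, (e / (normc c + 1)); rewrite divr_gt0.
  move=> x xP j jk; rewrite (seminormZ (pP j)).
  have := xP j jk; rewrite ltr_pdivlMr// mulrC; apply: le_lt_trans.
  by rewrite ler_wpM2r ?(seminorm_ge0 (pP j))// lerDl.
- move=> _ [k [e [e0 ->]]] a b x y ab xP yP j jk.
  apply: (le_lt_trans (seminormD (pP j) _ _)); rewrite !(seminormZ (pP j)).
  have {}ab : normc a + normc b <= 1 by move: ab; rewrite -lecR rmorphD.
  set M := Num.max (p j x) (p j y).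
  have M0 : 0 <= M by rewrite le_max (seminorm_ge0 (pP j)).
  apply: (@le_lt_trans _ _ ((normc a + normc b) * M)).
    rewrite mulrDl lerD// ler_wpM2l//.
      by rewrite le_max lexx.
    by rewrite le_max lexx orbT.
  apply: (@le_lt_trans _ _ M); first by rewrite -[leRHS]mul1r ler_wpM2r.
  by rewrite gt_max xP// yP.
- move=> _ [k [e [e0 ->]]] x.
  pose s : R := \sum_(j < k.+1) p j x.
  have s0 : 0 <= s by apply: sumr_ge0 => j _; exact: seminorm_ge0 (pP j) _.
  have s1 : 0 < s + 1 by rewrite ltr_wpDl.
  exists (e / (s + 1))%:C; first by rewrite ltcR divr_gt0.
  move=> c; rewrite -[`|c|]/((normc c)%:C) lecR => cP j jk.
  rewrite (seminormZ (pP j)).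
  apply: (@le_lt_trans _ _ (normc c * s)).
    rewrite ler_wpM2l// /s (bigD1 (Ordinal (jk : (j < k.+1)%N)))//= lerDl.
    by apply: sumr_ge0 => i _; exact: seminorm_ge0 (pP i) _.
  apply: (@le_lt_trans _ _ (e / (s + 1) * s)); first by rewrite ler_wpM2r.
  by rewrite mulrAC ltr_pdivrMr// ltr_pM2l// ltrDl.
Qed.

End SeminormTopology.

Section FinalTopology.
Context {K : numFieldType} {I : Type} (X : I -> tvsType K) {Y : lmodType K}.
Variable incl : forall i, X i -> Y.

(* The finest locally convex topology making all the [incl i] continuous *)
Definition final_base : set (set Y) :=
  [set W | absconvex W /\ forall i, nbhs (0 : X i) (@incl i @^-1` W)].

Lemma final_baseP : (forall i, linear (@incl i)) ->
  (forall y, exists i (x : X i), incl x = y) -> is_local_base final_base.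
Proof.
move=> lin onto; split.
- by exists setT; split=> // i; exact: filterT.
- move=> U V [Uc Un] [Vc Vn]; exists (U `&` V) => //; split.
    by move=> a b x y ab [Ux Vx] [Uy Vy]; split; [exact: Uc|exact: Vc].
  by move=> i; exact: filterI (Un i) (Vn i).
- move=> U c [Uc Un]; exists [set x | U (c *: x)] => //; split.
    move=> a b x y ab Ux Uy /=.
    by rewrite scalerDr !scalerA ![c * _]mulrC -!scalerA; exact: Uc.
  move=> i.
  have inclZ (x : X i) : incl (c *: x) = c *: incl x.
    have incl0 : incl (0 : X i) = 0.
      have := lin i (-1) 0 0; rewrite scaler0 addr0 scaleN1r => ->.
      by rewrite addNr.
    by rewrite -[c *: x]addr0 lin incl0 addr0.
  have := @scale_continuous K (X i) (c, 0) (@incl i @^-1` U).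
  rewrite /= scaler0 => /(_ (Un i))[[A1 A2] /= [A1c A20] A12].
  apply: filterS A20 => x A2x /=; rewrite -inclZ.
  by apply: (A12 (c, x)); split => //=; exact: nbhs_singleton.
- by move=> U [].
- move=> U [Uc Un] y; have [i [x <-]] := onto y.
  have incl0 : incl (0 : X i) = 0.
    have := lin i (-1) 0 0; rewrite scaler0 addr0 scaleN1r => ->.
    by rewrite addNr.
  have := @scale_continuous K (X i) (0, x) (@incl i @^-1` U).
  rewrite /= scale0r => /(_ (Un i))[[A1 A2] /= [A10 A2x] A12].
  move: A10 => /nbhs_ballP[r /= r0 rA1].
  exists (r / 2); first by rewrite divr_gt0.
  move=> c cr; rewrite -[_ *: _]addr0 -incl0 -lin addr0.
  apply: (A12 (c, x)); split => /=; last exact: nbhs_singleton.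
  apply: rA1; rewrite -ball_normE /ball_ /= sub0r normrN (le_lt_trans cr)//.
  by rewrite gtr_pMr// invf_lt1// ltr1n.
Qed.

End FinalTopology.

Section Smooth.
Context {R : realType} {n : nat}.
Local Notation Rn := 'rV[R]_n.
Local Notation fct := (Rn -> R[i]^o).
Implicit Types (f g : fct) (i : 'I_n) (k p : nat).

Definition fRe f : Rn -> R := fun x => complex.Re (f x).
Definition fIm f : Rn -> R := fun x => complex.Im (f x).
Definition ebase i : Rn := delta_mx 0 i.

(* A complex-valued function on R^n is differentiated through its real and
   imaginary parts, as [R[i]^o] is normed over [R[i]] and not over [R]. *)
Definition pderivable i f : Prop :=
  forall x, derivable (fRe f) x (ebase i) /\ derivable (fIm f) x (ebase i).

Definition pderiv i f : fct :=
  fun x => 'D_(ebase i) (fRe f) x +i* 'D_(ebase i) (fIm f) x.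

Fixpoint Ck k f : Prop :=
  continuous f /\
  if k is k'.+1 then forall i, pderivable i f /\ Ck k' (pderiv i f) else True.

Definition smooth f : Prop := forall k, Ck k f.

(* [D^q = d_0^(q 0) ... d_(n-1)^(q (n-1))], [d_i] the [i]-th partial derivative *)
Definition Dmulti (q : 'I_n -> nat) f : fct :=
  foldr (fun i => iter (q i) (pderiv i)) f (enum 'I_n).

Lemma fReD f g : fRe (f + g) = fRe f + fRe g.
Proof. by apply/funext => x; rewrite /fRe !fctE; case: (f x) (g x) => [? ?] []. Qed.

Lemma fImD f g : fIm (f + g) = fIm f + fIm g.
Proof. by apply/funext => x; rewrite /fIm !fctE; case: (f x) (g x) => [? ?] []. Qed.

Lemma fReZ (c : R[i]) f :
  fRe (c *: f) = (complex.Re c) \*: (fRe f) - (complex.Im c) \*: (fIm f).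
Proof.
by apply/funext => x; rewrite /fRe /fIm !fctE /=; case: c (f x) => [? ?] [].
Qed.

Lemma fImZ (c : R[i]) f :
  fIm (c *: f) = (complex.Re c) \*: (fIm f) + (complex.Im c) \*: (fRe f).
Proof.
by apply/funext => x; rewrite /fRe /fIm !fctE /=; case: c (f x) => [? ?] [].
Qed.

Lemma pderivableD i f g :
  pderivable i f -> pderivable i g -> pderivable i (f + g).
Proof.
move=> fi gi x; have [f1 f2] := fi x; have [g1 g2] := gi x.
by rewrite fReD fImD; split; exact: derivableD.
Qed.

Lemma pderivD i f g : pderivable i f -> pderivable i g ->
  pderiv i (f + g) = pderiv i f + pderiv i g.
Proof.
move=> fi gi; apply/funext => x; have [f1 f2] := fi x; have [g1 g2] := gi x.
by rewrite /pderiv fReD fImD !deriveD.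
Qed.

Lemma pderivableZ i c f : pderivable i f -> pderivable i (c *: f).
Proof.
move=> fi x; have [f1 f2] := fi x; rewrite fReZ fImZ; split.
  by apply: derivableB; exact: derivableZ.
by apply: derivableD; exact: derivableZ.
Qed.

Lemma pderivZ i c f : pderivable i f -> pderiv i (c *: f) = c *: pderiv i f.
Proof.
move=> fi; apply/funext => x; have [f1 f2] := fi x.
rewrite /pderiv fReZ fImZ deriveB ?deriveD ?deriveZ//; try exact: derivableZ.
by rewrite fctE; case: c => a b.
Qed.

Lemma Ck_cts k f : Ck k f -> continuous f.
Proof. by case: k => [|k] []. Qed.

Lemma CkD k f g : Ck k f -> Ck k g -> Ck k (f + g).
Proof.
elim: k f g => [|k IH] f g [cf Hf] [cg Hg]; (split;
    first by move=> x; apply: continuousD; [exact: cf|exact: cg]) => // i.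
have [fi Hfi] := Hf i; have [gi Hgi] := Hg i.
split; first exact: pderivableD.
by rewrite pderivD//; exact: IH.
Qed.

Lemma CkZ k c f : Ck k f -> Ck k (c *: f).
Proof.
elim: k f => [|k IH] f [cf Hf]; (split;
    first by move=> x; apply: continuousZr; exact: cf) => // i.
have [fi Hfi] := Hf i.
split; first exact: pderivableZ.
by rewrite pderivZ//; exact: IH.
Qed.

Lemma smoothD f g : smooth f -> smooth g -> smooth (f + g).
Proof. by move=> sf sg k; exact: CkD. Qed.

Lemma smoothZ c f : smooth f -> smooth (c *: f).
Proof. by move=> sf k; exact: CkZ. Qed.

Lemma smooth_pderivable i f : smooth f -> pderivable i f.
Proof. by move=> /(_ 1%N)[_ /(_ i)[]]. Qed.

Lemma smooth_pderiv i f : smooth f -> smooth (pderiv i f).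
Proof. by move=> sf k; have [_ /(_ i)[]] := sf k.+1. Qed.

Lemma pderiv0 i : pderiv i 0 = 0.
Proof.
apply/funext => x; rewrite /pderiv.
have -> : fRe 0 = cst 0 by apply/funext.
have -> : fIm 0 = cst 0 by apply/funext.
by rewrite !derive_cst.
Qed.

Lemma smooth0 : smooth 0.
Proof.
elim=> [|k IH]; (split; first by move=> x; exact: cst_continuous) => // i.
split; last by rewrite pderiv0.
move=> x; have -> : fRe 0 = cst 0 by apply/funext.
have -> : fIm 0 = cst 0 by apply/funext.
by split; exact: derivable_cst.
Qed.

Lemma smooth_iter_pderiv i k f : smooth f -> smooth (iter k (pderiv i) f).
Proof. by move=> sf; elim: k => //= k; exact: smooth_pderiv. Qed.

Lemma smooth_Dmulti q f : smooth f -> smooth (Dmulti q f).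
Proof.
move=> sf; rewrite /Dmulti; elim: (enum _) => //= i s.
exact: smooth_iter_pderiv.
Qed.

Lemma DmultiD q f g : smooth f -> smooth g ->
  Dmulti q (f + g) = Dmulti q f + Dmulti q g.
Proof.
move=> sf sg; rewrite /Dmulti.
pose D s h := foldr (fun i => iter (q i) (pderiv i)) h s.
rewrite -!/(D _ _).
have sD s h : smooth h -> smooth (D s h).
  by move=> sh; elim: s => //= i s; exact: smooth_iter_pderiv.
elim: (enum _) => //= i s ->; elim: (q i) => //= m ->.
by rewrite pderivD//; apply: smooth_pderivable; apply: smooth_iter_pderiv;
  exact: sD.
Qed.

Lemma DmultiZ q c f : smooth f -> Dmulti q (c *: f) = c *: Dmulti q f.
Proof.
move=> sf; rewrite /Dmulti.
pose D s h := foldr (fun i => iter (q i) (pderiv i)) h s.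
rewrite -!/(D _ _).
have sD s h : smooth h -> smooth (D s h).
  by move=> sh; elim: s => //= i s; exact: smooth_iter_pderiv.
elim: (enum _) => //= i s ->; elim: (q i) => //= m ->.
by rewrite pderivZ//; apply: smooth_pderivable; apply: smooth_iter_pderiv;
  exact: sD.
Qed.

Lemma Dmulti0 q : Dmulti q 0 = 0.
Proof.
rewrite /Dmulti; elim: (enum _) => //= i s ->.
by elim: (q i) => //= m ->; exact: pderiv0.
Qed.

End Smooth.

Section SeminormLemmas.
Context {R : realType}.

Lemma normc_ge0c (c : R[i]) : 0 <= normc c.
Proof. by case: c => a b; exact: sqrtr_ge0. Qed.

Lemma normc_dist (x y : R[i]) : `|normc x - normc y| <= normc (x - y).
Proof.
have H u v : normc u <= normc (u - v) + normc v :> R.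
  by apply: le_trans (le_normcD _ _); rewrite subrK.
rewrite ler_norml lerBlDr H andbT lerNl opprB lerBlDr.
by rewrite -(normcN (x - y)) opprB H.
Qed.

Lemma is_seminorm_le (E : lmodType R[i]) (p : E -> R) :
  (forall x, 0 <= p x) -> (forall x y, p (x + y) <= p x + p y) ->
  (forall c x, p (c *: x) <= normc c * p x) -> is_seminorm p.
Proof.
move=> p0 pD pZ; split=> // c x; apply/eqP; rewrite eq_le pZ /=.
have [->|c0] := eqVneq c 0; first by rewrite normc0 mul0r p0.
have nc0 : 0 < normc c.
  by rewrite lt_def normc_ge0c andbT; apply: contra_neq c0 => /eq0_normc.
rewrite mulrC -ler_pdivlMr// mulrC -normcV.
by rewrite -{1}[x](scalerK c0); exact: pZ.
Qed.

Lemma sup_seminorm (E : lmodType R[i]) (T : Type) (A : set T)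
    (F : E -> T -> R) :
  (forall t, A t -> is_seminorm (F ^~ t)) ->
  (forall x, exists M, forall t, A t -> F x t <= M) ->
  is_seminorm (fun x => sup [set F x t | t in A]).
Proof.
move=> Fs Fb.
have ub x t : A t -> F x t <= sup [set F x t | t in A].
  move=> At; apply: ub_le_sup; last by exists t.
  by have [M MP] := Fb x; exists M => _ [u Au <-]; exact: MP.
have supge0 x : 0 <= sup [set F x t | t in A].
  have [/eqP A0|/set0P[t At]] := boolP (A == set0).
    by rewrite A0 image_set0 sup0.
  by apply: le_trans (ub x t At); exact: seminorm_ge0 (Fs t At) _.
have lub x M : 0 <= M -> (forall t, A t -> F x t <= M) ->
    sup [set F x t | t in A] <= M.
  move=> M0 MP; have [/eqP A0|/set0P[t At]] := boolP (A == set0).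
    by rewrite A0 image_set0 sup0.
  by apply: ge_sup => [|_ [u Au <-]]; [exists (F x t), t|exact: MP].
apply: is_seminorm_le => //.
- move=> x y; apply: lub => [|t At]; first exact: addr_ge0.
  by apply: le_trans (seminormD (Fs t At) _ _) _; rewrite lerD// ub.
- move=> c x; apply: lub => [|t At]; first by rewrite mulr_ge0 ?normc_ge0c.
  by rewrite (seminormZ (Fs t At)) ler_wpM2l ?normc_ge0c// ub.
Qed.

Lemma bigmax_seminorm (E : lmodType R[i]) (I : finType) (P : pred I)
    (F : E -> I -> R) :
  (forall i, is_seminorm (F ^~ i)) ->
  is_seminorm (fun x => \big[Num.max/0]_(i | P i) F x i).
Proof.
move=> Fs; have max0 x : 0 <= \big[Num.max/0]_(i | P i) F x i.
  exact: bigmax_ge_id.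
apply: is_seminorm_le => //.
- move=> x y; apply: bigmax_le => [|i Pi]; first exact: addr_ge0.
  by apply: le_trans (seminormD (Fs i) _ _) _; rewrite lerD// le_bigmax_cond.
- move=> c x; apply: bigmax_le => [|i Pi]; first by rewrite mulr_ge0 ?normc_ge0c.
  by rewrite (seminormZ (Fs i)) ler_wpM2l ?normc_ge0c// le_bigmax_cond.
Qed.

End SeminormLemmas.

Section TestFunctions.
Context {R : realType} {n : nat}.
Local Notation Rn := 'rV[R]_n.
Local Notation fct := (Rn -> R[i]^o).

(* [`|x|] is the maximum norm on ['rV[R]_n]. *)
Definition enorm (x : Rn) : R := Num.sqrt (\sum_(i < n) x 0 i ^+ 2).

Definition mdeg (q : 'I_n -> nat) : nat := \sum_(i < n) q i.

(* The multi-indices of length [<= p] have entries [<= p], hence are ranged over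
   by the finite type [{ffun 'I_n -> 'I_p.+1}]. *)
Definition mindex p (q : {ffun 'I_n -> 'I_p.+1}) : 'I_n -> nat :=
  fun i => q i.

Definition monom (k : 'I_n -> nat) (x : Rn) : R := \prod_(i < n) x 0 i ^+ k i.

Definition supported_in (a : R) (f : fct) : Prop :=
  forall x, a < enorm x -> f x = 0.

Definition rapidly_decreasing (f : fct) : Prop :=
  forall k q : 'I_n -> nat, exists M : R,
    forall x, normc ((monom k x)%:C * Dmulti q f x) <= M.

Definition norm_Da (a : R) (p : nat) (f : fct) : R :=
  sup [set \big[Num.max/0]_(q : {ffun 'I_n -> 'I_p.+1} | (mdeg (mindex q) <= p)%N)
             normc (Dmulti (mindex q) f x) | x in [set x | enorm x <= a]].

Definition norm_S (p : nat) (f : fct) : R :=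
  sup [set let '(k, q, x) := t in normc ((monom (mindex k) x)%:C * Dmulti (mindex q) f x)
      | t in [set t : {ffun 'I_n -> 'I_p.+1} * {ffun 'I_n -> 'I_p.+1} * Rn
              | (mdeg (mindex t.1.1) <= p)%N && (mdeg (mindex t.1.2) <= p)%N]].

Lemma enorm_ge (x : Rn) i : `|x 0 i| <= enorm x.
Proof.
rewrite -sqrtr_sqr ler_wsqrtr// (bigD1 i)//= lerDl.
by apply: sumr_ge0 => j _; exact: sqr_ge0.
Qed.

Lemma continuous_bounded (a : R) (f : fct) : continuous f ->
  exists M, forall x, enorm x <= a -> normc (f x) <= M.
Proof.
move=> cf.
have cnf : continuous (fun x => normc (f x) : R^o).
  move=> x; apply/(@cvgrPdist_lt _ R^o _ (nbhs x) _) => e e0.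
  have e0' : 0 < e%:C :> R[i] by rewrite ltcR.
  have H := @cvgr_dist_lt _ _ _ (nbhs x) _ f (f x) (cf x) _ e0'.
  near=> y; have : `|f x - f y| < e%:C by near: y; exact: H.
  rewrite -[`|f x - f y|]/((normc (f x - f y))%:C) ltcR.
  by apply: le_lt_trans; exact: normc_dist.
pose A := [set v : Rn | forall i, `[- a, a]%classic (v 0 i)].
have cA : compact A.
  exact: (@rV_compact R n (fun=> `[- a, a]%classic) (fun=> @segment_compact _ _ _)).
have := @continuous_compact _ _ _ A (continuous_subspaceT cnf) cA.
move=> /compact_bounded[M [Mr MP]]; exists (M + 1) => x xa.
have MM : M < M + 1 by rewrite ltrDl.
have Ax : ((fun x => normc (f x) : R^o) @` A) (normc (f x)).
  by exists x => // i /=; rewrite in_itv/= -ler_norml (le_trans (enorm_ge _ _)).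
have {}MP : `|normc (f x)| <= M + 1 by exact: MP MM _ Ax.
by move: MP; rewrite ger0_norm// normc_ge0c.
Unshelve. all: by end_near. Qed.

End TestFunctions.

Section Da.
Context (R : realType) (n : nat) (a : R).
Local Notation fct := ('rV[R]_n -> R[i]^o).

Definition Da_pred : {pred fct} :=
  fun f => `[< smooth f /\ supported_in a f >].

Record testDa : Type := TestDa { Da_val :> fct ; _ : Da_val \in Da_pred }.

HB.instance Definition _ := [isSub for Da_val].
HB.instance Definition _ := [Choice of testDa by <:].

Lemma Da_submod : submod_closed Da_pred.
Proof.
split; first by apply/asboolP; split; [exact: smooth0|].
move=> c f g /asboolP[sf f0] /asboolP[sg g0]; apply/asboolP; split.
  by apply: smoothD => //; exact: smoothZ.
by move=> x ax; rewrite !fctE f0// g0// scaler0 addr0.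
Qed.

HB.instance Definition _ :=
  GRing.isSubmodClosed.Build R[i] fct Da_pred Da_submod.
HB.instance Definition _ := [SubChoice_isSubLmodule of testDa by <:].

Lemma testDa_smooth (f : testDa) : smooth f.
Proof. by case: f => f /= /asboolP[]. Qed.

Lemma norm_Da_seminorm p :
  is_seminorm (fun f : testDa => norm_Da a p f).
Proof.
apply: (@sup_seminorm R testDa _ [set x | enorm x <= a]
  (fun f x => \big[Num.max/0]_(q : {ffun 'I_n -> 'I_p.+1} | (mdeg (mindex q) <= p)%N)
             normc (Dmulti (mindex q) f x))).
  move=> x _; apply: bigmax_seminorm => q; split.
  - by move=> f; exact: normc_ge0c.
  - move=> f g; rewrite -[Da_val (f + g)]/(Da_val f + Da_val g).
    by rewrite DmultiD; [exact: le_normcD|exact: testDa_smooth..].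
  - move=> c f; rewrite -[Da_val (c *: f)]/(c *: Da_val f).
    by rewrite DmultiZ; [exact: normcM|exact: testDa_smooth].
move=> f.
have /choice[M MP] : forall q : {ffun 'I_n -> 'I_p.+1}, exists M : R,
    forall x, enorm x <= a -> normc (Dmulti (mindex q) f x) <= M.
  move=> q; apply: continuous_bounded.
  by apply: (@Ck_cts _ _ 0); exact: smooth_Dmulti (testDa_smooth f) _.
exists (\big[Num.max/0]_(q : {ffun 'I_n -> 'I_p.+1}) M q) => x xa.
apply: bigmax_le => [|q _]; first exact: bigmax_ge_id.
by apply: le_trans (MP q x xa) _; exact: le_bigmax_cond.
Qed.

HB.instance Definition _ := hasLocalBase.Build R[i] testDa
  (seminorm_baseP norm_Da_seminorm).

End Da.
Arguments testDa : clear implicits.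

Section S.
Context (R : realType) (n : nat).
Local Notation fct := ('rV[R]_n -> R[i]^o).

Definition S_pred : {pred fct} :=
  fun f => `[< smooth f /\ rapidly_decreasing f >].

Record testS : Type := TestS { S_val :> fct ; _ : S_val \in S_pred }.

HB.instance Definition _ := [isSub for S_val].
HB.instance Definition _ := [Choice of testS by <:].

Lemma S_submod : submod_closed S_pred.
Proof.
split.
  apply/asboolP; split; first exact: smooth0.
  by move=> k q; exists 0 => x; rewrite Dmulti0 -[0 x]/(0 : R[i]) mulr0 normc0.
move=> c f g /asboolP[sf rf] /asboolP[sg rg]; apply/asboolP; split.
  by apply: smoothD => //; exact: smoothZ.
move=> k q; have [M MP] := rf k q; have [M' MP'] := rg k q.
exists (normc c * M + M') => x.
rewrite DmultiD//; last exact: smoothZ.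
rewrite DmultiZ// !fctE mulrDr (le_trans (le_normcD _ _))// lerD//.
rewrite -[c *: _]/(c * _) mulrCA normcM ler_wpM2l//.
exact: normc_ge0c.
Qed.

HB.instance Definition _ :=
  GRing.isSubmodClosed.Build R[i] fct S_pred S_submod.
HB.instance Definition _ := [SubChoice_isSubLmodule of testS by <:].

Lemma testS_smooth (f : testS) : smooth f.
Proof. by case: f => f /= /asboolP[]. Qed.

Lemma testS_rapid (f : testS) : rapidly_decreasing f.
Proof. by case: f => f /= /asboolP[]. Qed.

Lemma norm_S_seminorm p : is_seminorm (fun f : testS => norm_S p f).
Proof.
apply: (@sup_seminorm R testS).
  move=> [[k q] x] _; split.
  - by move=> f; exact: normc_ge0c.
  - move=> f g; rewrite -[S_val (f + g)]/(S_val f + S_val g).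
    rewrite DmultiD ?mulrDr; [exact: le_normcD|exact: testS_smooth..].
  - move=> c f; rewrite -[S_val (c *: f)]/(c *: S_val f).
    rewrite DmultiZ; last exact: testS_smooth.
    by rewrite fctE -[c *: _]/(c * _) mulrCA normcM.
move=> f; have /choice[M MP] : forall kq : {ffun 'I_n -> 'I_p.+1} *
    {ffun 'I_n -> 'I_p.+1}, exists M : R,
    forall x, normc ((monom (mindex kq.1) x)%:C * Dmulti (mindex kq.2) f x) <= M.
  by move=> [k q]; exact: testS_rapid.
exists (\big[Num.max/0]_kq M kq) => -[[k q] x] _.
by apply: le_trans (MP (k, q) x) _; exact: le_bigmax_cond.
Qed.

HB.instance Definition _ := hasLocalBase.Build R[i] testS
  (seminorm_baseP norm_S_seminorm).

End S.
Arguments testS : clear implicits.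

Section D.
Context (R : realType) (n : nat).
Local Notation fct := ('rV[R]_n -> R[i]^o).

Definition D_pred : {pred fct} :=
  fun f => `[< exists m : nat, (0 < m)%N /\ f \in Da_pred m%:R >].

Record testD : Type := TestD { D_val :> fct ; _ : D_val \in D_pred }.

HB.instance Definition _ := [isSub for D_val].
HB.instance Definition _ := [Choice of testD by <:].

Lemma D_submod : submod_closed D_pred.
Proof.
split; first by apply/asboolP; exists 1%N; split=> //; exact: rpred0.
move=> c f g /asboolP[m [m0 /asboolP[sf fm]]] /asboolP[l [l0 /asboolP[sg gl]]].
apply/asboolP; exists (maxn m l); rewrite leq_max m0; split=> //.
apply: rpredD; first apply: rpredZ; apply/asboolP; split=> // x mx.
  by apply: fm; apply: le_lt_trans mx; rewrite ler_nat leq_maxl.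
by apply: gl; apply: le_lt_trans mx; rewrite ler_nat leq_maxr.
Qed.

HB.instance Definition _ :=
  GRing.isSubmodClosed.Build R[i] fct D_pred D_submod.
HB.instance Definition _ := [SubChoice_isSubLmodule of testD by <:].

Lemma D_incl_subproof (m : nat) (f : testDa R n m.+1%:R) :
  (f : fct) \in D_pred.
Proof. by apply/asboolP; exists m.+1; split=> //; case: f. Qed.

Definition D_incl (m : nat) (f : testDa R n m.+1%:R) : testD :=
  TestD (D_incl_subproof f).

Lemma D_incl_linear m : linear (@D_incl m).
Proof. by move=> c f g; apply/val_inj. Qed.

Lemma D_incl_onto (f : testD) : exists m (g : testDa R n m.+1%:R), D_incl g = f.
Proof.
case: f => f fP; have /asboolP[[|m] [// _ fm]] := fP.
by exists m, (TestDa fm); apply/val_inj.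
Qed.

(* The strict inductive limit of the spaces [testDa R n m], [1 <= m] *)
HB.instance Definition _ := hasLocalBase.Build R[i] testD
  (@final_baseP R[i] nat (fun m => testDa R n m.+1%:R) testD D_incl
     D_incl_linear D_incl_onto).

End D.
Arguments testD : clear implicits.

Variant test_space (R : realType) (n : nat) : tvsType R[i] -> Prop :=
| test_space_Da (a : R) of 0 < a : test_space n (testDa R n a)
| test_space_D : test_space n (testD R n)
| test_space_S : test_space n (testS R n).

Section DemiDistributions.
Context {R : realType}.
Local Notation C := R[i]^o.

Definition C0_class (gamma : C -> C) : Prop :=
  [/\ gamma t @[t --> (0 : C)^'] --> (0 : C),
      gamma 0 = 0
    & forall t : C, `|t| <= 1 -> `|t| <= `|gamma t|].

Definition Lgamma (X Y : topologicalLmodType R[i]) (gamma : C -> C) (U : set X)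
    : set (X -> Y) :=
  [set f | f 0 = 0 /\
    forall (x u : X) (t : C), U u -> `|t| <= 1 ->
      exists r s : C, [/\ `|r - 1| <= `|gamma t|, `|s| <= `|gamma t|
                        & f (x + t *: u) = r *: f x + s *: f u]].

Definition Kgamma (X Y : topologicalLmodType R[i]) (gamma : C -> C) (U : set X)
    : set (X -> Y) :=
  [set f | Lgamma gamma U f /\
    forall (x u : X) (t : C), U u -> `|t| <= 1 ->
      exists s : C, `|s| <= `|gamma t| /\ f (x + t *: u) = f x + s *: f u].

Definition Cball (eps : R) : set C := [set z | `|z| < eps%:C].

Definition demi_dist (E : topologicalLmodType R[i]) (gamma : C -> C)
    (U : set E) : set (E -> C) :=
  [set f | continuous f /\ Lgamma gamma U f].

Definition demi_distK (E : topologicalLmodType R[i]) (gamma : C -> C)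
    (U : set E) : set (E -> C) :=
  [set f | continuous f /\ Kgamma gamma U f].

End DemiDistributions.

(* Main.v *)
Require Import Defs.
From mathcomp Require Import all_boot all_order all_algebra complex.
From mathcomp Require Import all_classical all_reals all_analysis.
Import Order.TTheory GRing.Theory Num.Theory.
Import numFieldNormedType.Exports.
Import ComplexField.Normc.
Local Open Scope classical_set_scope.
Local Open Scope ring_scope.
Local Open Scope complex_scope.

(** Let [u] be so small that [u] lies in [U] and [f u] in the [eps]-disc. Since
    [f] belongs to the class [Kgamma], replacing [x] by [x + t *: u] moves the
    value [f x] exactly by a multiple [s *: f u] with [`|s| <= `|gamma1 t| <= 1].
    This is a displacement of the kind that the defining condition on [h] speaks
    of, with coefficient [s] and direction [f u]; the errors it allows are at
    most [`|gamma1 s|], hence at most [`|gamma1 (gamma1 t)|] by monotonicity.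
    So [V] can be [U] intersected with the preimage of the disc, which is a
    neighborhood of 0 because [f] is continuous and vanishes at 0
    ([Lgamma_comp], [Kgamma_comp]).

    What remains is continuity of [h], and it is automatic ([Lgamma_continuous])
    because [C] has dimension one over its scalars: a single nonzero [u] of the
    disc reaches every point near [x] in the form [x + t *: u] with [t] small. *)

Section GammaClasses.
Context {R : realType}.
Local Notation C := R[i]^o.
Implicit Types gamma delta : C -> C.

Lemma C0_class_cvg gamma : C0_class gamma -> gamma t @[t --> (0 : C)] --> (0 : C).
Proof.
move=> [g0 g00 _].
have /continuous_withinNx g_cts : gamma t @[t --> (0 : C)^'] --> gamma 0.
  by rewrite g00.
have : gamma t @[t --> (0 : C)] --> gamma 0 by exact: g_cts.
by rewrite g00.
Qed.

(** The bound on [gamma] keeps [gamma t] in the unit disc, the only region where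
    the lower bound on [`|delta|] is available. *)
Lemma C0_class_comp gamma delta :
  (forall t : C, `|t| <= 1 -> `|gamma t| <= 1) ->
  C0_class gamma -> C0_class delta -> C0_class (delta \o gamma).
Proof.
move=> gamma1 Cg Cd; have [_ g0 gge] := Cg; have [_ d0 dge] := Cd; split.
- apply: cvg_comp (C0_class_cvg _ Cd).
  by apply: cvg_trans (C0_class_cvg _ Cg); apply: cvg_app; exact: nbhs_dnbhs.
- by rewrite /= g0.
- by move=> t t1; rewrite (le_trans (gge _ t1))//= dge// gamma1.
Qed.

Section Composition.
Context {X Y Z : topologicalLmodType R[i]}.
Context (gamma delta : C -> C).
Hypothesis gamma_le1 : forall t : C, `|t| <= 1 -> `|gamma t| <= 1.
Hypothesis delta_mono : forall a b : C, `|a| <= `|b| -> `|b| <= 1 ->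
  `|delta a| <= `|delta b|.

(** If [f] were merely in [Lgamma], then [f (x + t *: u)] would start from
    [r *: f x] instead of [f x], and nothing would relate [h (r *: f x)] to
    [h (f x)]; hence the asymmetry between the two factors. *)
Lemma Lgamma_comp (U : set X) (W : set Y) (f : X -> Y) (h : Y -> Z) :
  Kgamma gamma U f -> Lgamma delta W h ->
  Lgamma (delta \o gamma) (U `&` f @^-1` W) (h \o f).
Proof.
move=> [[f0 _] Kf] [h0 Lh]; split=> [|x u t [Uu Wfu] t1]; first by rewrite /= f0.
have [s [sg fE]] := Kf x u t Uu t1.
have [r [s' [rd s'd hE]]] := Lh (f x) (f u) s Wfu (le_trans sg (gamma_le1 t t1)).
exists r, s'; rewrite /= fE; split=> //.
  exact/(le_trans rd)/delta_mono/gamma_le1.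
exact/(le_trans s'd)/delta_mono/gamma_le1.
Qed.

Lemma Kgamma_comp (U : set X) (W : set Y) (f : X -> Y) (h : Y -> Z) :
  Kgamma gamma U f -> Kgamma delta W h ->
  Kgamma (delta \o gamma) (U `&` f @^-1` W) (h \o f).
Proof.
move=> Kf [Lh Kh]; split=> [|x u t [Uu Wfu] t1]; first exact: Lgamma_comp.
have [s [sg fE]] := Kf.2 x u t Uu t1.
have [s' [s'd hE]] := Kh (f x) (f u) s Wfu (le_trans sg (gamma_le1 t t1)).
exists s'; rewrite /= fE; split=> //.
exact/(le_trans s'd)/delta_mono/gamma_le1.
Qed.

End Composition.

(** For a fixed nonzero [u] of the disc, [h (x + t *: u)] differs from [h x] by
    at most [`|gamma t| * (`|h x| + `|h u|)], which tends to 0 with [t]; and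
    [t] is proportional to the displacement. *)
Lemma Lgamma_continuous gamma (eps : R) (h : C -> C) :
  0 < eps -> C0_class gamma -> Lgamma gamma (Cball eps) h -> continuous h.
Proof.
move=> eps0 Cg [_ Lh] x; have xF : Filter (nbhs x) by exact: nbhs_filter.
pose u : C := (eps / 2)%:C.
have u0 : u != 0 by rewrite gt_eqF// ltcR divr_gt0.
have Uu : Cball eps u.
  by rewrite /Cball /= ger0_norm ?ltcR ?lecR ?divr_ge0 ?ltW// ltr_pdivrMr//
     ltr_pMr// ltr1n.
pose t (y : C) : C := (y - x) / u.
have t0 : t y @[y --> x] --> (0 : C).
  have : t y @[y --> x] --> (x - x) / u.
    apply: (@cvgMr_tmp R[i] _ (nbhs x)).
    exact: (@cvgB _ C _ _ _ id (cst x) _ _ cvg_id (cvg_cst x)).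
  by rewrite subrr mul0r.
have gt0 : gamma (t y) @[y --> x] --> (0 : C).
  exact: cvg_comp t0 (C0_class_cvg _ Cg).
pose M := `|h x| + `|h u| + 1.
have M0 : 0 < M by rewrite ltr_wpDl// addr_ge0.
apply/(@cvgrPdist_lt _ C _ (nbhs x)) => e e0.
have t1 : \forall y \near x, `|t y| <= 1.
  by move/cvgr0Pnorm_le : t0 => /(_ 1 ltr01).
have ge : \forall y \near x, `|gamma (t y)| < e / M.
  by move/cvgr0Pnorm_lt : gt0 => /(_ (e / M)); apply; rewrite divr_gt0.
near=> y.
have [r [s [rg sg hE]]] : exists r s : C, [/\ `|r - 1| <= `|gamma (t y)|,
    `|s| <= `|gamma (t y)| & h y = r *: h x + s *: h u].
  have -> : y = x + t y *: u by rewrite /t /GRing.scale /= divfK// addrC subrK.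
  have -> : t (x + t y *: u) = t y.
    by rewrite {1}/t addrAC subrr add0r /GRing.scale /= mulfK.
  by apply: Lh => //; near: y; exact: t1.
rewrite distrC hE.
have -> : r *: h x + s *: h u - h x = (r - 1) *: h x + s *: h u.
  by rewrite scalerBl scale1r addrAC.
have : `|gamma (t y)| < e / M by near: y; exact: ge.
rewrite ltr_pdivlMr//; apply: le_lt_trans.
rewrite (le_trans (ler_normD _ _))// !normrM.
apply: (@le_trans _ _ (`|gamma (t y)| * (`|h x| + `|h u|))).
  by rewrite mulrDr lerD// ler_wpM2r.
by rewrite ler_wpM2l// lerDl.
Unshelve. all: by end_near. Qed.

End GammaClasses.

Theorem theorem1p6 (R : realType) (n : nat) (hn : (0 < n)%N)
  (E : tvsType R[i]) (hE : test_space n E)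
  (gamma1 : R[i]^o -> R[i]^o) (hgamma1 : C0_class gamma1)
  (hsup : ereal_sup [set (normc (gamma1 t))%:E
                    | t in [set t : R[i]^o | `|t| <= 1]] = 1%E)
  (hmono : forall alpha beta : R[i]^o, `|alpha| <= `|beta| -> `|beta| <= 1 ->
     `|gamma1 alpha| <= `|gamma1 beta|)
  (U : set E) (hU : nbhs (0 : E) U)
  (f : E -> R[i]^o) (hf : demi_distK gamma1 U f)
  (eps : R) (heps : 0 < eps) :
  exists V : set E,
    [/\ nbhs (0 : E) V,
        C0_class (gamma1 \o gamma1),
        forall h : R[i]^o -> R[i]^o, Lgamma gamma1 (Cball eps) h ->
          demi_dist (gamma1 \o gamma1) V (h \o f)
      & forall h : R[i]^o -> R[i]^o, Kgamma gamma1 (Cball eps) h ->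
          demi_distK (gamma1 \o gamma1) V (h \o f)].
Proof.
have gamma1_le1 (t : R[i]^o) : `|t| <= 1 -> `|gamma1 t| <= 1.
  move=> t1; rewrite -[`|gamma1 t|]/((normc (gamma1 t))%:C) lecR -lee_fin -hsup.
  by apply: ereal_sup_ubound; exists t.
have [cf Kf] := hf; have f0 : f 0 = 0 by case: Kf => [[]].
exists (U `&` f @^-1` Cball eps); split.
- apply: filterI => //.
  apply: (cf 0); rewrite f0; apply/nbhs_ballP.
  exists eps%:C; first by rewrite /= ltcR.
  by move=> z; rewrite -ball_normE /ball_ /Cball /= sub0r normrN.
- exact: C0_class_comp.
- move=> h Lh; split; last exact: Lgamma_comp.
  by move=> x; apply: continuous_comp; [exact: cf|exact: Lgamma_continuous Lh _].
- move=> h Kh; split; last exact: Kgamma_comp.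
  move=> x; apply: continuous_comp; first exact: cf.
  exact: Lgamma_continuous Kh.1 _.
Qed.
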